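(* Let $\alpha:[0,1]\to[0,1]$, $t\mapsto\alpha_t$, be a noise schedule with $\alpha_0=1$ and $\alpha_1=0$, let $\boldsymbol\mu_\theta$ be a data prediction network on sequences of length $L\ge 1$, and let $\mathbf x_0\in\{0,\dots,m-1\}^L$ be a data sequence (with no mask token). Then the sequence negative evidence lower bound $$\mathcal L_\infty^{(L)}=\int_{0}^1\frac{\alpha_t'}{1-\alpha_t}\,\mathbb E_{\mathbf x_t\sim q_{t|0}(\cdot|\mathbf x_0)}\Big[\sum_{l:\,x_t^{(l)}=m}\mathbf e_{x_0^{(l)}}^\top\log \boldsymbol\mu_\theta^{(l)}(\mathbf x_t,t)\Big]\,\mathrm dt$$ can be written as $$\mathcal L_\infty^{(L)}=-\sum_{n=1}^L\mathbb E_{\mathbf x_n\sim\tilde q_{n|0}(\cdot|\mathbf x_0)}\Big[\frac1n\sum_{l:\,x_n^{(l)}=m}\mathbf e_{x_0^{(l)}}^\top\log\bar{\boldsymbol\mu}_\theta^{(l)}(\mathbf x_n)\Big],$$ where, for a sequence $\mathbf x_n$ with exactly $n$ mask tokens, $$\log\bar{\boldsymbol\mu}_\theta(\mathbf x_n)=\mathbb E_{a\sim\mathcal B(L-n+1,\,n)}\big[\log\boldsymbol\mu_\theta(\mathbf x_n,\alpha^{-1}(a))\big],$$ $\alpha^{-1}$ is the inverse function of $t\mapsto\alpha_t$ (so $\alpha^{-1}(\alpha_t)=t$), and $\mathcal B(a,b)$ denotes the Beta distribution with shape parameters $a,b>0$.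
   Context: The vocabulary is $\mathcal X=\{0,1,\dots,m-1,m\}$, where $0,\dots,m-1$ are data tokens and $m$ is the mask token. For $x\in\mathcal X$, $\mathbf e_x\in\mathbb R^{m+1}$ is the one-hot vector of $x$. $\Delta^m=\{\boldsymbol\pi\in\mathbb R^{m+1}:\pi_i\ge 0,\ \sum_{i=0}^m\pi_i=1\}$. For a sequence $\mathbf x\in\mathcal X^L$, $x^{(l)}$ is its $l$-th token. The noise schedule $\alpha$ is differentiable and strictly decreasing on $[0,1]$; $\alpha_t'=\mathrm d\alpha_t/\mathrm dt$. Forward process: $q_{t|0}(\mathbf x_t|\mathbf x_0)=\prod_{l=1}^L q_{t|0}(x_t^{(l)}|x_0^{(l)})$, where $q_{t|0}(\cdot|x_0)$ is the categorical distribution with probability vector $\alpha_t\mathbf e_{x_0}+(1-\alpha_t)\mathbf e_m$; that is, each token is independently kept with probability $\alpha_t$ and replaced by $m$ with probability $1-\alpha_t$. Discrete forward process: for $0\le n\le L$, $\tilde q_{n|0}(\cdot|\mathbf x_0)$ is the law of the sequence obtained from $\mathbf x_0$ by choosing a uniformly random set of $n$ of the $L$ positions and replacing the tokens at these positions by $m$. Network: $\boldsymbol\mu_\theta:\mathcal X^L\times\mathbb R\to(\Delta^m)^L$ is measurable in time, and $\boldsymbol\mu_\theta^{(l)}(\mathbf x,t)\in\Delta^m$ denotes its $l$-th column. If $x^{(l)}=m$, then $\boldsymbol\mu_\theta^{(l)}(\mathbf x,t)=[\mathrm{softmax}(\mathbf f_\theta^{(l)}(\mathbf x,t)),0]$ for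 some $\mathbf f_\theta^{(l)}(\mathbf x,t)\in\mathbb R^m$ (so its entries at $0,\dots,m-1$ are positive and its entry at $m$ is $0$); if $x^{(l)}\ne m$, then $\boldsymbol\mu_\theta^{(l)}(\mathbf x,t)=\mathbf e_{x^{(l)}}$. Logarithms of vectors and matrices are entrywise, and $\mathbf e_x^\top\log\boldsymbol\mu$ simply means $\log$ of the $x$-th entry of $\boldsymbol\mu$ (so entries equal to $0$ at index $m$ never contribute). Since all logarithms are $\le0$, all expectations and integrals are well defined, possibly infinite. *)

(* Defs.v *)
From mathcomp Require Import all_boot all_order all_algebra.
From mathcomp Require Import all_classical all_reals all_analysis.
Import Order.TTheory GRing.Theory Num.Theory.
Import numFieldNormedType.Exports.

Set Implicit Arguments.
Unset Strict Implicit.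
Unset Printing Implicit Defensive.

Local Open Scope classical_set_scope.
Local Open Scope ring_scope.

(** Tokens are the elements of ['I_(m + 1)]: the data tokens are the
    [lshift 1 i] with [i : 'I_m], and the last one is the mask.  The shape
    [m + 1] (rather than [m.+1]) allows column vectors to be split with
    [col_mx] into their data part and their mask entry. *)

Definition mask_token (m : nat) : 'I_(m + 1) := rshift m ord0.

Definition token_seq (L m : nat) := {ffun 'I_L -> 'I_(m + 1)}.

Definition nmask (L m : nat) (x : token_seq L m) : nat :=
  #|[pred l | x l == mask_token m]|.

Definition onehot (R : realType) (k : nat) (x : 'I_k) : 'cV[R]_k :=
  delta_mx x 0.

Definition simplex (R : realType) (k : nat) : set 'cV[R]_k :=
  [set p | (forall i, 0 <= p i 0) /\ \sum_i p i 0 = 1].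

Definition softmax (R : realType) (k : nat) (f : 'cV[R]_k) : 'cV[R]_k :=
  \col_i (expR (f i 0) / \sum_j expR (f j 0)).

(** Derivatives relative to a set [A]: on [`[0, 1]] these are the ordinary
    ones at interior points and the one-sided ones at [0] and [1]. *)

Definition derivable_in (R : realType) (A : set R) (f : R -> R) (t : R) : Prop :=
  cvg ((f s - f t) / (s - t) @[s --> within A t^']).

Definition derive_in (R : realType) (A : set R) (f : R -> R) (t : R) : R :=
  lim ((f s - f t) / (s - t) @[s --> within A t^']).

Record noise_schedule (R : realType) (alpha : R -> R) : Prop := NoiseSchedule {
  schedule_range : forall t : R, t \in `[0, 1] -> alpha t \in `[0, 1];
  schedule_derivable : forall t : R, t \in `[0, 1] -> derivable_in `[0, 1] alpha t;
  schedule_decreasing : forall s t : R, s \in `[0, 1] -> t \in `[0, 1] ->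
    s < t -> alpha t < alpha s
}.

Record data_prediction_network (R : realType) (L m : nat)
    (mu : token_seq L m -> R -> 'M[R]_(m + 1, L)) : Prop :=
  DataPredictionNetwork {
  network_simplex : forall x t l, simplex (col l (mu x t));
  network_measurable : forall x i l,
    measurable_fun [set: R] (fun t => mu x t i l);
  network_masked : forall (x : token_seq L m) t (l : 'I_L), x l = mask_token m ->
    exists f : 'cV[R]_m, col l (mu x t) = col_mx (softmax f) 0;
  network_unmasked : forall (x : token_seq L m) t (l : 'I_L), x l <> mask_token m ->
    col l (mu x t) = onehot R (x l)
}.

(** Entrywise logarithm, with [log 0 = -oo]. *)
Definition logmx (R : realType) (p q : nat) (A : 'M[R]_(p, q)) :
    'M[\bar R]_(p, q) :=
  map_mx (fun r : R => lne r%:E) A.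

(** Expectation under a probability mass function on a finite type; the
    product convention [0 * -oo = 0] discards the points of mass zero. *)
Definition expect (R : realType) (T : finType) (p : T -> R) (F : T -> \bar R) :
    \bar R :=
  (\sum_x (p x)%:E * F x)%E.

Definition forward_token (R : realType) (m : nat) (alpha : R -> R) (t : R)
    (x0 : 'I_(m + 1)) : 'cV[R]_(m + 1) :=
  alpha t *: onehot R x0 + (1 - alpha t) *: onehot R (mask_token m).

Definition forward (R : realType) (L m : nat) (alpha : R -> R) (t : R)
    (x0 : token_seq L m) : token_seq L m -> R :=
  fun x => \prod_l forward_token alpha t (x0 l) (x l) 0.

Definition mask_at (L m : nat) (S : {set 'I_L}) (x : token_seq L m) :
    token_seq L m :=
  [ffun l => if l \in S then mask_token m else x l].

(** Push-forward, under [S |-> mask_at S x0], of the uniform distribution on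
    the ['C(L, n)] sets of [n] positions. *)
Definition discrete_forward (R : realType) (L m n : nat) (x0 : token_seq L m) :
    token_seq L m -> R :=
  fun x => \sum_(S : {set 'I_L} | (#|S| == n) && (mask_at S x0 == x))
    ('C(L, n)%:R)^-1.

Definition nelbo (R : realType) (L m : nat) (alpha : R -> R)
    (mu : token_seq L m -> R -> 'M[R]_(m + 1, L)) (x0 : token_seq L m) : \bar R :=
  (\int[lebesgue_measure]_(t in `[0%R, 1%R])
    ((derive_in `[0%R, 1%R] alpha t / (1 - alpha t))%R%:E *
     expect (forward alpha t x0) (fun x =>
       (\sum_(l | x l == mask_token m) logmx (mu x t) (x0 l) l)%E)))%E.

(** [alphaV] stands for the inverse of the schedule, which is only meaningful
    on [`[0, 1]]; this set carries the whole mass of the Beta distribution. *)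
Definition log_mubar (R : realType) (L m : nat) (alphaV : R -> R)
    (mu : token_seq L m -> R -> 'M[R]_(m + 1, L)) (x : token_seq L m) :
    'M[\bar R]_(m + 1, L) :=
  \matrix_(i, l)
    (\int[beta_prob (L - nmask x + 1) (nmask x)]_(a in `[0%R, 1%R])
      logmx (mu x (alphaV a)) i l)%E.

(* Main.v *)
(** The integrand of the NELBO is a sum over the sets S of masked positions.
    For |S| = n, its S-term is (-alpha'(t)) alpha(t)^(L-n) (1-alpha(t))^(n-1)
    times the loss at (x_S, t), so the substitution a = alpha(t) turns it into
    the integral of the loss at (x_S, alpha^-1(a)) against
    a^(L-n) (1-a)^(n-1) da.  This is the Beta(L-n+1, n) distribution up to the
    factor B(L-n+1, n) = 1 / (n C(L, n)), which is exactly the weight of S on the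
    right-hand side.

    Since alpha' need not be continuous, the substitution rests on the
    fundamental theorem of calculus for monotone functions that are merely
    differentiable: it identifies the image under alpha of the measure
    -alpha'(t) dt with Lebesgue measure on [0, 1].  An increment is bounded by
    the integral of the derivative by means of a locally dominating majorant of
    almost the same integral; the reverse bound follows by applying this to
    n t - f(t) and letting n tend to infinity.  Both sides of the statement may
    be infinite, so all integrals are those of nonnegative functions. *)
Require Import Defs.
From HB Require Import structures.
From mathcomp Require Import all_boot all_order all_algebra.
From mathcomp Require Import all_classical all_reals all_analysis.
From mathcomp Require Import measurable_realfun zify ring lra.
Import Order.TTheory GRing.Theory Num.Theory.
Import numFieldNormedType.Exports.

Set Implicit Arguments.
Unset Strict Implicit.
Unset Printing Implicit Defensive.

Local Open Scope classical_set_scope.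
Local Open Scope ring_scope.

(** * Fundamental theorem of calculus for a nonnegative right derivative *)

(* G is the sum of the functions c_k 1_{U_k}, where U_k is an open neighbourhood
   of the level set {k d <= g < (k+1) d} of nearly the same measure and
   c_k = (k+1) d. *)
Lemma near_majorant (R : realType) (D : set R) (g : R -> R) (e : R) :
  measurable D -> (lebesgue_measure D < +oo)%E ->
  measurable_fun D g -> (forall t, D t -> 0 <= g t) -> 0 < e ->
  exists G : R -> \bar R, [/\ measurable_fun [set: R] G, (forall t, 0 <= G t)%E,
    (forall t, D t -> \forall s \near t, ((g t)%:E <= G s)%E) &
    (\int[lebesgue_measure]_(t in D) G t <=
     \int[lebesgue_measure]_(t in D) (g t)%:E + e%:E)%E].
Proof.
move=> mD Doo mg g0 e0.
set mu := @lebesgue_measure R.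
have muD : mu D \is a fin_num by rewrite ge0_fin_numE.
set V := fine (mu D); have V0 : 0 <= V by exact: fine_ge0.
(* This mesh gives [d * V <= e / 2], so raising [g] by [d] on [D] costs half of the error; the [1 +]
   keeps the division valid when [V = 0]. *)
set d := e / 2 / (1 + V).
have d0 : 0 < d by rewrite /d !divr_gt0// ltr_wpDr.
pose E k := D `&` g @^-1` `[k%:R * d, k.+1%:R * d[.
have mE k : measurable (E k) by exact: mg.
have EE t : D t -> exists2 k, E k t & k%:R * d <= g t < k.+1%:R * d.
  move=> Dt; have gd0 : 0 <= g t / d by rewrite divr_ge0 ?g0// ltW.
  have := Num.Theory.truncn_itv gd0.
  rewrite ler_pdivlMr// ltr_pdivrMr// => h.
  by exists (Num.truncn (g t / d)) => //; split => //=; rewrite in_itv.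
have tE : trivIset setT E.
  apply/trivIsetP => i j _ _ ij; apply/seteqP; split => // t [[_ +] [_]].
  rewrite /= !in_itv/= => /andP[i1 i2] /andP[j1 j2].
  move/eqP : ij; apply.
  have := le_lt_trans i1 j2; have := le_lt_trans j1 i2.
  rewrite !ltr_pM2r// !ltr_nat !ltnS => h1 h2; apply/eqP.
  by rewrite eqn_leq h1 h2.
have Eoo k : (mu (E k) < +oo)%E.
  apply: (@le_lt_trans _ _ (mu D)) => //; apply: le_measure; rewrite ?inE//.
    exact: mE.
  exact: subIsetl.
pose c k : R := k.+1%:R * d.
have c0 k : 0 < c k by rewrite mulr_gt0.
(* The excess measure of [U k] is scaled by [1 / c k], so that weighted by [c k] it stays below the
   [k]-th term of a series with sum [e / 2]. *)
have /choice [U HU] : forall k, exists V : set R, [/\ open V, E k `<=` V &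
    (mu (V `\` E k) < ((e / 2) / (2 ^ k.+1)%:R / c k)%:E)%E].
  move=> k; apply: lebesgue_regularity_outer => //.
  by rewrite !divr_gt0// ltr0n expn_gt0.
have mO k : measurable (U k) by apply: open_measurable; case: (HU k).
have mD' : measurable (D : set (measurableTypeR R)) by exact: mD.
have mE' k : measurable (E k : set (measurableTypeR R)) by exact: mE.
have mO' k : measurable (U k : set (measurableTypeR R)) by exact: mO.
pose h k t : \bar R := (c k * \1_(U k) t)%:E.
have h0 k t : (0 <= h k t)%E by rewrite lee_fin mulr_ge0// ltW.
have mh k A : measurable A -> measurable_fun A (h k).
  by move=> mA; apply/measurable_EFinP/measurable_funM => //; exact: measurable_indic.
exists (fun t => \sum_(0 <= k <oo) h k t)%E; split.
- by apply: ge0_emeasurable_sum => // k _; exact: mh.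
- by move=> t; exact: nneseries_ge0.
- move=> t Dt; have [k Ek /andP[_ gk]] := EE t Dt.
  have [oO EO _] := HU k.
  have : \forall s \near t, U k s by apply: open_nbhs_nbhs; split => //; exact: EO.
  apply: filterS => s Os.
  rewrite (@nneseriesD1 _ _ k)//.
  apply: (@le_trans _ _ (h k s)); last by rewrite leeDl// nneseries_ge0.
  by rewrite lee_fin indicE mem_set// mulr1 ltW.
rewrite integral_nneseries//; last by move=> k; exact: mh.
(* Inside [D], the set [U k] is covered by [E k], where [c k <= g + d], and by the excess, whose
   cost was fixed above. *)
have step k : (\int[mu]_(t in D) h k t <=
    \int[mu]_(t in E k) (g t + d)%:E + ((e / 2) / (2 ^ k.+1)%:R)%:E)%E.
  rewrite /h; under eq_integral do rewrite EFinM.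
  rewrite ge0_integralZl_EFin//; last 2 first.
    apply/measurable_EFinP; exact: measurable_indic.
    exact: ltW.
  rewrite integral_indic//.
  have [oO EO lO] := HU k.
  apply: (@le_trans _ _ ((c k)%:E * (mu (E k) + mu (U k `\` E k))))%E.
    rewrite lee_pmul2l ?lte_fin//.
    rewrite -measureU//; last 2 first.
      exact: measurableD.
      by apply/seteqP; split => // t [? []].
    apply: le_measure; rewrite ?inE//.
    - exact: measurableI.
    - by apply: measurableU => //; exact: measurableD.
    - move=> t [Ot Dt]; have [|] := pselect (E k t); first by left.
      by right.
  rewrite muleDr//; last by rewrite ge0_adde_def// inE.
  apply: leeD.
    rewrite -[leLHS]integral_cst//.
    apply: ge0_le_integral => //.
    + by move=> t _; rewrite lee_fin ltW.
    + apply/measurable_EFinP; apply: measurable_funD => //.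
      by apply: (measurable_funS mD _ mg); exact: subIsetl.
    + move=> t [Dt]; rewrite /= in_itv/= => /andP[kt _].
      by rewrite lee_fin /c -natr1 mulrDl mul1r lerD2r.
  by rewrite -lee_pdivlMl// -EFinM mulrC; exact: ltW.
apply: (le_trans (lee_nneseries _ (fun n _ => step n))).
  by move=> k _ _; apply: integral_ge0.
apply: (le_trans (epsilon_trick _ _ _)).
- by move=> k; apply: integral_ge0 => t [Dt _]; rewrite lee_fin addr_ge0 ?g0// ltW.
- by rewrite divr_ge0// ltW.
have UE : \bigcup_k E k = D.
  apply/seteqP; split => [t [k _ []]//|t Dt].
  by have [k Ek _] := EE t Dt; exists k.
rewrite -(@ge0_integral_bigcup _ _ _ mu E (fun t => (g t + d)%:E)) ?UE//; last 2 first.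
- by apply/measurable_EFinP; apply: measurable_funD.
- by move=> t Dt; rewrite lee_fin addr_ge0 ?g0// ltW.
under eq_integral do rewrite EFinD.
rewrite ge0_integralD//; last 2 first.
- by apply/measurable_EFinP.
- by move=> t _; rewrite lee_fin ltW.
rewrite -addeA leeD2l// integral_cst//= -[X in (_ * X)%E](fineK muD) -EFinM -EFinD lee_fin.
rewrite -/V /d [leRHS](splitr e) lerD2r.
rewrite mulrAC ler_pdivrMr ?ltr_wpDr//.
by rewrite ler_wpM2l// ?divr_ge0 ?ltW// ltrDr.
Qed.

(* For a near-majorant G of g, the x such that f x - f a is at most the integral
   of G over [a, x[, up to a small multiple of x - a, form a set closed under
   suprema; the bound on the right difference quotients prevents its supremum
   from being less than b. *)
Lemma increment_le_integral (R : realType) (f g : R -> R) (a b : R) :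
  a <= b ->
  measurable_fun `[a, b[ g -> (forall t, a <= t < b -> 0 <= g t) ->
  (forall t, a < t <= b -> f s @[s --> t^'-] --> f t) ->
  (forall t, a <= t < b -> forall e : R, 0 < e ->
    \forall s \near t^'+, f s - f t <= (g t + e) * (s - t)) ->
  ((f b - f a)%:E <= \int[lebesgue_measure]_(t in `[a, b[) (g t)%:E)%E.
Proof.
move=> ab mg g0 fl fr.
set mu := @lebesgue_measure R.
apply/lee_addgt0Pr => e e0.
have muab : (mu `[a, b[%classic < +oo)%E.
  by rewrite /mu lebesgue_measure_itv/=; case: ifP => _; rewrite ?ltry// -EFinB ltry.
have [G [mG G0 gG intG]] : exists G : R -> \bar R,
    [/\ measurable_fun [set: R] G, (forall t, 0 <= G t)%E,
    (forall t, a <= t < b -> \forall s \near t, ((g t)%:E <= G s)%E) &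
    (\int[mu]_(t in `[a, b[) G t <=
     \int[mu]_(t in `[a, b[) (g t)%:E + (e / 2)%:E)%E].
  have [|||G [mG G0 gG intG]] := @near_majorant R `[a, b[%classic g (e / 2) _ muab mg.
  - exact: measurable_itv.
  - by move=> t /=; rewrite in_itv/=; exact: g0.
  - by rewrite divr_gt0.
  - by exists G; split => // t t01; apply: gG; rewrite /= in_itv.
(* Chosen so that [d * (b - a) <= e / 2]; the other half of [e] is the error of the majorant [G]. *)
pose d := e / 2 / (1 + (b - a)).
have d0 : 0 < d by rewrite !divr_gt0// ltr_pwDl// subr_ge0.
pose I x := (\int[mu]_(t in `[a, x[) G t)%E.
have mGA (A : set R) : measurable_fun A G by apply: measurable_funTS.
have I0 x : (0 <= I x)%E by apply: integral_ge0.
have Ile x y : x <= y -> (I x <= I y)%E.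
  move=> xy; apply: ge0_subset_integral => //; first exact: mGA.
  by apply: subset_itvl; rewrite bnd_simp.
pose T := [set x | a <= x <= b /\ ((f x - f a)%:E <= I x + (d * (x - a))%:E)%E].
have Ta : T a by split; rewrite ?lexx// !subrr mulr0 adde0.
have Tb x : T x -> x <= b by case=> /andP[].
have hT : has_sup T by split; [exists a|exists b].
pose c := sup T.
have Tc x : T x -> x <= c by move=> Tx; apply: ub_le_sup => //; exists b.
have ac : a <= c by exact: Tc.
have cb : c <= b by apply: ge_sup => //; exists a.
(* If the inequality failed at [c], left continuity of [f] would make [f x - f a] exceed
   [I c + d (c - a)] for all [x] just left of [c]. Some point of [T] lies there, and its own bound
   is smaller because [I] is monotone. *)
have TC : T c.
  split; first by rewrite ac cb.
  have [->|ca] := eqVneq c a; first by case: Ta.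
  have {ca}ca : a < c by rewrite lt_neqAle eq_sym ca.
  rewrite leNgt; apply/negP => lt.
  have Icfin : I c \is a fin_num.
    rewrite ge0_fin_numE//; apply: le_lt_trans (lt_trans lt (ltry _)).
    by rewrite leeDl// lee_fin mulr_ge0 ?subr_ge0// ltW.
  rewrite -(fineK Icfin) -EFinD lte_fin in lt.
  have : \forall s \near c^'-, fine (I c) + d * (c - a) + f a < f s.
    have /fl/cvgr_gt : a < c <= b by rewrite ca.
    by apply; lra.
  move=> [r /= r0 Hr].
  have [x Tx xc] := sup_adherent r0 hT.
  have xlec := Tc _ Tx.
  have [xE|xneq] := eqVneq x c.
    case: Tx => _; rewrite xE -(fineK Icfin) -EFinD lee_fin; lra.
  have {xneq}xltc : x < c by rewrite lt_neqAle xneq.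
  have := Hr x; rewrite /= ger0_norm ?subr_ge0// => /(_ _ xltc) => H.
  have {}H : fine (I c) + d * (c - a) + f a < f x by apply: H; move: xc; rewrite -/c; lra.
  case: Tx => _ Tx.
  have : ((f x - f a)%:E <= I c + (d * (c - a))%:E)%E.
    apply: (le_trans Tx); apply: leeD; first exact: Ile.
    by rewrite lee_fin ler_pM2l// lerD2r.
  rewrite -(fineK Icfin) -EFinD lee_fin; lra.
have [cE|cneq] := eqVneq c b.
  move: TC; rewrite cE => -[_ h]; apply: (le_trans h).
  apply: (@le_trans _ _ (\int[mu]_(t in `[a, b[) (g t)%:E + (e / 2)%:E + (e / 2)%:E)%E).
    apply: leeD => //; rewrite lee_fin /d mulrAC ler_pdivrMr; last by lra.
    by rewrite ler_wpM2l// ?lerDr// divr_ge0// ltW.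
  by rewrite -addeA -EFinD -splitr.
have {cneq}cltb : c < b by rewrite lt_neqAle cneq.
exfalso.
have accb : a <= c < b by rewrite ac.
have [r /= r0 Hr] := gG c accb.
have [q /= q0 Hq] := fr c accb d d0.
(* Half of the least of the three radii keeps [s] strictly inside the region where [G >= g c],
   inside the region where the quotient bound holds, and below [b]. *)
pose s := c + Num.min (Num.min r q) (b - c) / 2.
have [m0 [mr mq mb]] : 0 < Num.min (Num.min r q) (b - c) /\
   [/\ Num.min (Num.min r q) (b - c) <= r, Num.min (Num.min r q) (b - c) <= q
    & Num.min (Num.min r q) (b - c) <= b - c].
  by split; [rewrite !lt_min r0 q0 subr_gt0|split; rewrite !ge_min lexx ?orbT].
have cs : c < s by rewrite /s; lra.
suff : T s by move/Tc; rewrite leNgt cs.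
split; first by rewrite /s; lra.
have Is : (I c + (g c * (s - c))%:E <= I s)%E.
  have asE : `[a, s[%classic = `[a, c[%classic `|` `[c, s[%classic.
    by apply: itv_bndbnd_setU; rewrite bnd_simp// ltW.
  rewrite /I asE.
  rewrite ge0_integral_setU//; last 2 first.
  - exact: mGA.
  - by apply/disj_setPLR => x /=; rewrite !in_itv/= => /andP[_ ?] /andP[]; lra.
  apply: leeD => //.
  apply: (@le_trans _ _ (\int[mu]_(t in `[c, s[) cst (g c)%:E t)%E).
    rewrite integral_cst//= /mu lebesgue_measure_itv/= lte_fin cs.
    by rewrite -EFinB -EFinM.
  apply: ge0_le_integral => //.
  - by move=> x _; rewrite lee_fin g0.
  - exact: mGA.
  - move=> x /=; rewrite in_itv/= => /andP[cx xs]; apply: Hr.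
    rewrite /= distrC ger0_norm ?subr_ge0//; move: xs; rewrite /s; lra.
apply: (@le_trans _ _ (I c + (g c * (s - c))%:E + (d * (s - a))%:E)%E); last first.
  exact: leeD.
have Hs : f s - f c <= (g c + d) * (s - c).
  apply: Hq => //.
  by rewrite /= distrC ger0_norm ?subr_ge0 1?ltW// /s; lra.
case: TC => _ h.
apply: (@le_trans _ _ ((f c - f a)%:E + ((g c + d) * (s - c))%:E)%E).
  rewrite -EFinD lee_fin; lra.
apply: (le_trans (leeD2r _ h)).
move: (I c) => J; rewrite -!addeA -!EFinD; apply: leeD2l; rewrite lee_fin; lra.
Qed.

(** One inequality is the increment lemma for [f]. For the other, [d] is truncated at height [n]:
    the increment lemma for [n t - f t], with bound [n - min(d, n)], gives that the integral of
    [min(d, n)] is at most [f b - f a], and monotone convergence removes the truncation. *)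
Lemma integral_right_derivative (R : realType) (f d : R -> R) (a b : R) :
  a <= b ->
  measurable_fun `[a, b[ d -> (forall t, a <= t < b -> 0 <= d t) ->
  (forall t, a < t <= b -> f s @[s --> t^'-] --> f t) ->
  (forall t, a <= t < b -> (f s - f t) / (s - t) @[s --> t^'+] --> d t) ->
  (\int[lebesgue_measure]_(t in `[a, b[) (d t)%:E = (f b - f a)%:E)%E.
Proof.
move=> ab md d0 fl fr; set mu := @lebesgue_measure R.
apply/eqP; rewrite eq_le; apply/andP; split; last first.
  apply: increment_le_integral => // t tab e e0.
  near=> s; have st : 0 < s - t by rewrite subr_gt0; near: s; exact: nbhs_right_gt.
  rewrite -ler_pdivrMr// ltW//; near: s.
  by apply: (cvgr_lt _ (fr t tab)); rewrite ltrDl.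
have mmin n : measurable_fun `[a, b[ (fun t => Num.min (d t) n%:R).
  by apply: measurable_minr.
have mminB n : measurable_fun `[a, b[ (fun t => n%:R - Num.min (d t) n%:R).
  exact: measurable_funB.
have min0 n t : a <= t < b -> 0 <= Num.min (d t) n%:R.
  by move=> tab; rewrite le_min d0// ler0n.
have Hn n : (\int[mu]_(t in `[a, b[) (Num.min (d t) n%:R)%:E <= (f b - f a)%:E)%E.
  have : ((n%:R * b - f b - (n%:R * a - f a))%:E <=
      \int[mu]_(t in `[a, b[) (n%:R - Num.min (d t) n%:R)%:E)%E.
    apply: (@increment_le_integral R (fun t => n%:R * t - f t)) => //.
    - by move=> t tab; rewrite subr_ge0 ge_min lexx orbT.
    - move=> t tab; apply: cvgB; last exact: fl.
      by apply: cvgMr; apply: cvg_at_left_filter; exact: cvg_id.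
    - move=> t tab e e0.
      near=> s; have st : 0 < s - t by rewrite subr_gt0; near: s; exact: nbhs_right_gt.
      have : d t - e < (f s - f t) / (s - t).
        by near: s; apply: (cvgr_gt _ (fr t tab)); rewrite gtrBl.
      rewrite ltr_pdivlMr// => h.
      have -> : n%:R * s - f s - (n%:R * t - f t) = n%:R * (s - t) - (f s - f t) by ring.
      have : Num.min (d t) n%:R <= d t by rewrite ge_min lexx.
      move/(ler_wpM2r (ltW st)); lra.
  set A := (X in (_ <= X)%E); set B := (X in _ -> (X <= _)%E) => hA.
  have A0 : (0 <= A)%E.
    by apply: integral_ge0 => t _; rewrite lee_fin subr_ge0 ge_min lexx orbT.
  have B0 : (0 <= B)%E.
    by apply: integral_ge0 => t; rewrite /= in_itv/= => tab; rewrite lee_fin min0.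
  (* The two complementary integrals have the finite sum [n (b - a)], so each is finite and the
     lower bound on [A] becomes an upper bound on [B]. *)
  have AB : (A + B = (n%:R * (b - a))%:E)%E.
    rewrite -ge0_integralD//; last 4 first.
    - by move=> t _; rewrite lee_fin subr_ge0 ge_min lexx orbT.
    - by apply/measurable_EFinP; exact: mminB.
    - by move=> t; rewrite /= in_itv/= => tab; rewrite lee_fin min0.
    - by apply/measurable_EFinP; exact: mmin.
    under eq_integral do rewrite -EFinD subrK.
    rewrite integral_cst//= /mu lebesgue_measure_itv/= lte_fin.
    have [ltab|] := ltP a b; first by rewrite -EFinB -EFinM.
    by move=> ba; rewrite mule0 (@le_anti _ _ a b) ?ab// subrr mulr0.
  have Afin : A \is a fin_num.
    by rewrite ge0_fin_numE//; apply: le_lt_trans (ltry (n%:R * (b - a))); rewrite -AB leeDl.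
  have Bfin : B \is a fin_num.
    by rewrite ge0_fin_numE//; apply: le_lt_trans (ltry (n%:R * (b - a))); rewrite -AB leeDr.
  move: AB hA; rewrite -(fineK Afin) -(fineK Bfin) -EFinD !lee_fin => -[].
  lra.
have -> : (\int[mu]_(t in `[a, b[) (d t)%:E =
    limn (fun n => \int[mu]_(t in `[a, b[) (Num.min (d t) n%:R)%:E))%E.
  rewrite -monotone_convergence//.
  - apply: eq_integral => t tab; apply/esym/lim_near_cst => //.
    near=> n; rewrite min_l//; near: n; exact: nbhs_infty_ger.
  - by move=> n; apply/measurable_EFinP; exact: mmin.
  - move=> t tab m n mn; rewrite lee_fin le_min !ge_min lexx/=.
    by rewrite ler_nat mn orbT.
apply: lime_le; last by near=> n; exact: Hn.
apply: ereal_nondecreasing_is_cvgn => m n mn.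
apply: ge0_le_integral => //.
- by move=> t; rewrite /= in_itv/= => tab; rewrite lee_fin min0.
- by apply/measurable_EFinP; exact: mmin.
- by apply/measurable_EFinP; exact: mmin.
- move=> t tab; rewrite lee_fin le_min !ge_min lexx/=.
  by rewrite ler_nat mn orbT.
Unshelve. all: by end_near. Qed.

(** * Measures given by a density *)

Section density.
Local Open Scope ereal_scope.
Context d (T : measurableType d) (R : realType).
Variables (mu : {measure set T -> \bar R}) (w : T -> R).
Hypotheses (mw : measurable_fun setT w) (w0 : forall x, (0 <= w x)%R).

(** The two proofs are arguments of the term so that the measure structure declared below can be
    inferred from it. *)
Definition density of measurable_fun setT w & (forall x, 0 <= w x)%R :=
  fun A : set T => \int[mu]_(x in A) (w x)%:E.

Local Notation nu := (density mw w0).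

Let density0 : nu set0 = 0.
Proof. by rewrite /density integral_set0. Qed.

Let density_ge0 A : 0 <= nu A.
Proof. by apply: integral_ge0 => x _; rewrite lee_fin. Qed.

Let density_sigma_additive : semi_sigma_additive nu.
Proof.
move=> F mF tF mUF; rewrite /density; apply: cvg_toP.
  apply: ereal_nondecreasing_is_cvgn => m n mn.
  by apply: lee_sum_nneg_natr => // k _ _; exact: density_ge0.
rewrite ge0_integral_bigcup//.
- by apply/measurable_EFinP; exact: measurable_funTS.
- by move=> x _; rewrite lee_fin.
Qed.

HB.instance Definition _ := isMeasure.Build _ _ _ nu
  density0 density_ge0 density_sigma_additive.

End density.

Section ge0_integral_density.
Local Open Scope ereal_scope.
Context d (T : measurableType d) (R : realType).
Variables (mu nu : {measure set T -> \bar R}) (w : T -> R).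
Hypotheses (mw : measurable_fun setT w) (w0 : forall x, (0 <= w x)%R)
  (nuE : forall A, measurable A -> nu A = \int[mu]_(x in A) (w x)%:E).

Import HBNNSimple.

Let ge0_integral_density_nnsfun (D : set T) (h : {nnsfun T >-> R}) :
  measurable D ->
  \int[nu]_(x in D) (h x)%:E = \int[mu]_(x in D) ((h x)%:E * (w x)%:E).
Proof.
move=> mD.
have mwD : measurable_fun D (EFin \o w) by apply/measurable_EFinP; exact: measurable_funTS.
have mk k : measurable (h @^-1` [set k]) by [].
have mi k : measurable_fun D (fun x => (\1_(h @^-1` [set k]) x)%:E : \bar R).
  by apply/measurable_EFinP.
under eq_integral do rewrite fimfunE -fsumEFin//.
rewrite ge0_integral_fsum//; last 2 first.
- by move=> y; exact/measurable_EFinP/measurable_funM.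
- by move=> y x _; rewrite nnfun_muleindic_ge0.
under [RHS]eq_integral.
  move=> x xD; rewrite fimfunE -fsumEFin// ge0_mule_fsuml; last first.
    by move=> k; rewrite EFinM nnfun_muleindic_ge0.
  over.
rewrite [RHS]ge0_integral_fsum//; last 2 first.
- by move=> y; apply: emeasurable_funM => //; exact/measurable_EFinP/measurable_funM.
- by move=> y x _; apply: mule_ge0; rewrite lee_fin// -lee_fin EFinM nnfun_muleindic_ge0.
apply: eq_fsbigr => k _.
rewrite integralZl_indic_nnsfun// integral_indic// nuE; last exact: measurableI.
under [RHS]eq_integral do rewrite EFinM -muleA.
(* A nonnegative simple function takes no negative value, so such a level set is empty; for [k >= 0]
   the scalar can leave the integral. *)
have [k0|k0] := ltP k 0%R.
  rewrite preimage_nnfun0// set0I integral_set0 mule0.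
  under eq_integral do rewrite indic0 mul0e mule0.
  by rewrite integral0.
rewrite ge0_integralZl_EFin//; last 2 first.
- by move=> x _; rewrite mule_ge0// lee_fin.
- exact: emeasurable_funM.
congr (_ * _); rewrite setIC integral_mkcondr; apply: eq_integral => x _.
by rewrite epatch_indic muleC.
Qed.

(** Increasing simple functions converge to [f], and since [w >= 0] their products with [w] increase
    as well, so monotone convergence applies on both sides. Keeping [nu] arbitrary lets the lemma
    serve both [density] and [beta_prob]. *)
Lemma ge0_integral_density (D : set T) (f : T -> \bar R) :
  measurable D -> measurable_fun D f -> (forall x, D x -> 0 <= f x) ->
  \int[nu]_(x in D) f x = \int[mu]_(x in D) (f x * (w x)%:E).
Proof.
move=> mD mf f0; pose f_ := nnsfun_approx mD mf.
have mwD : measurable_fun D (EFin \o w) by apply/measurable_EFinP; exact: measurable_funTS.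
have mf_ n : measurable_fun D (EFin \o f_ n).
  by apply/measurable_EFinP; exact: measurable_funTS.
have nd x : {homo (fun n => (f_ n x)%:E) : m n / (m <= n)%N >-> m <= n}.
  by move=> m n mn; rewrite lee_fin; exact/lefP/nd_nnsfun_approx.
have cf x : D x -> (f_ n x)%:E @[n --> \oo] --> f x.
  by move=> Dx; exact: cvg_nnsfun_approx.
transitivity (limn (fun n => \int[nu]_(x in D) (f_ n x)%:E)).
  rewrite -monotone_convergence//.
  - apply: eq_integral => x /[!inE] xD; apply/esym/cvg_lim => //; exact: cf.
  - by move=> n x _; rewrite lee_fin.
transitivity (limn (fun n => \int[mu]_(x in D) ((f_ n x)%:E * (w x)%:E))).
  by congr (limn _); apply/funext => n; exact: ge0_integral_density_nnsfun.
rewrite -monotone_convergence//.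
- apply: eq_integral => x /[!inE] xD; apply/cvg_lim => //.
  by apply: cvgeMr => //; exact: cf.
- by move=> n; apply: emeasurable_funM => //; exact: mf_.
- by move=> n x _; rewrite mule_ge0// lee_fin.
- by move=> x _ m n mn; apply: lee_wpmul2r; [rewrite lee_fin|exact: nd].
Qed.

End ge0_integral_density.

(** * Continuity, monotonicity and measurability of the schedule *)

Lemma cvg_schedule_quotient (R : realType) (alpha : R -> R)
    (halpha : noise_schedule alpha) (t : R) : 0 <= t <= 1 ->
  (alpha s - alpha t) / (s - t) @[s --> within `[0, 1] t^'] --> derive_in `[0, 1] alpha t.
Proof. by move=> t01; apply: (schedule_derivable halpha); rewrite in_itv. Qed.

Lemma cvg_schedule_quotient_right (R : realType) (alpha : R -> R)
    (halpha : noise_schedule alpha) (t : R) : 0 <= t < 1 ->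
  (alpha s - alpha t) / (s - t) @[s --> t^'+] --> derive_in `[0, 1] alpha t.
Proof.
move=> /andP[t0 t1]; apply: cvg_trans (cvg_schedule_quotient halpha _); last by rewrite t0 ltW.
apply: cvg_app => P [e /= e0 He].
near=> s; apply: He.
- rewrite /= distrC ger0_norm ?subr_ge0.
    by rewrite ltrBlDl; near: s; apply: nbhs_right_lt; rewrite ltrDl.
  by near: s; exact: nbhs_right_ge.
- by rewrite gt_eqF//; near: s; exact: nbhs_right_gt.
- rewrite /= in_itv/=; apply/andP; split.
    by rewrite (le_trans t0)//; near: s; exact: nbhs_right_ge.
  by near: s; exact: nbhs_right_le.
Unshelve. all: by end_near. Qed.

Lemma cvg_schedule_quotient_left (R : realType) (alpha : R -> R)
    (halpha : noise_schedule alpha) (t : R) : 0 < t <= 1 ->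
  (alpha s - alpha t) / (s - t) @[s --> t^'-] --> derive_in `[0, 1] alpha t.
Proof.
move=> /andP[t0 t1]; apply: cvg_trans (cvg_schedule_quotient halpha _); last by rewrite t1 ltW.
apply: cvg_app => P [e /= e0 He].
near=> s; apply: He.
- rewrite /= ger0_norm ?subr_ge0.
    by rewrite ltrBlDl -ltrBlDr; near: s; apply: nbhs_left_gt; rewrite ltrBlDr ltrDl.
  by near: s; exact: nbhs_left_le.
- by rewrite lt_eqF//; near: s; exact: nbhs_left_lt.
- rewrite /= in_itv/=; apply/andP; split.
    by near: s; exact: nbhs_left_ge.
  by rewrite (le_trans _ t1)//; near: s; exact: nbhs_left_le.
Unshelve. all: by end_near. Qed.

(** [alpha s] equals [alpha t] plus the quotient times [s - t], and the second factor tends to 0. A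
    general filter covers the left and the right limit at once. *)
Lemma cvg_of_difference_quotient (R : realType) (alpha : R -> R) (t l : R)
    (F : set_system R) : ProperFilter F ->
  F --> t -> (\forall s \near F, s != t) -> (alpha s - alpha t) / (s - t) @[s --> F] --> l ->
  alpha s @[s --> F] --> alpha t.
Proof.
move=> FF Ft Fne qF.
have : alpha t + (alpha s - alpha t) / (s - t) * (s - t) @[s --> F] --> alpha t + l * (t - t).
  apply: cvgD; first exact: cvg_cst.
  by apply: cvgM => //; apply: cvgB => //; exact: cvg_cst.
rewrite subrr mulr0 addr0; apply: cvg_trans; apply: near_eq_cvg.
near=> s; rewrite divfK ?subr_eq0; last by near: s.
by rewrite addrC subrK.
Unshelve. all: by end_near. Qed.

Lemma schedule_left_continuous (R : realType) (alpha : R -> R)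
    (halpha : noise_schedule alpha) (t : R) : 0 < t <= 1 ->
  alpha s @[s --> t^'-] --> alpha t.
Proof.
move=> t01; apply: cvg_of_difference_quotient (cvg_schedule_quotient_left halpha t01).
- by apply: cvg_at_left_filter; exact: cvg_id.
- by near=> s; rewrite lt_eqF//; near: s; exact: nbhs_left_lt.
Unshelve. all: by end_near. Qed.

Lemma schedule_right_continuous (R : realType) (alpha : R -> R)
    (halpha : noise_schedule alpha) (t : R) : 0 <= t < 1 ->
  alpha s @[s --> t^'+] --> alpha t.
Proof.
move=> t01; apply: cvg_of_difference_quotient (cvg_schedule_quotient_right halpha t01).
- by apply: cvg_at_right_filter; exact: cvg_id.
- by near=> s; rewrite gt_eqF//; near: s; exact: nbhs_right_gt.
Unshelve. all: by end_near. Qed.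

Lemma schedule_continuous (R : realType) (alpha : R -> R)
    (halpha : noise_schedule alpha) : {within `[0, 1], continuous alpha}.
Proof.
apply/continuous_within_itvP => //; split.
- move=> t; rewrite in_itv/= => /andP[t0 t1].
  apply/left_right_continuousP; split.
    by apply: (schedule_left_continuous halpha); rewrite t0 ltW.
  by apply: (schedule_right_continuous halpha); rewrite t1 ltW.
- by apply: (schedule_right_continuous halpha); rewrite lexx ltr01.
- by apply: (schedule_left_continuous halpha); rewrite lexx ltr01.
Qed.

Lemma schedule_surjective (R : realType) (alpha : R -> R)
    (halpha : noise_schedule alpha) (x : R) : alpha 0 = 1 -> alpha 1 = 0 ->
  0 <= x <= 1 -> exists2 t, 0 <= t <= 1 & alpha t = x.
Proof.
move=> a0 a1 x01; have [|t t01 <-] := @IVT R alpha 0 1 x ler01 (schedule_continuous halpha).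
  by rewrite a0 a1 min_r// max_l.
by exists t; move: t01; rewrite ?in_itv.
Qed.

Lemma derive_in_schedule_le0 (R : realType) (alpha : R -> R)
    (halpha : noise_schedule alpha) (t : R) : 0 <= t < 1 ->
  derive_in `[0, 1] alpha t <= 0.
Proof.
move=> t01; apply: (cvgr_to_le (cvg_schedule_quotient_right halpha t01)).
have /andP[t0 t1] := t01.
near=> s; have ts : t < s by near: s; exact: nbhs_right_gt.
rewrite pmulr_lle0 ?invr_gt0 ?subr_gt0// subr_le0 ltW//.
apply: (schedule_decreasing halpha) => //.
  by rewrite in_itv/= t0 ltW.
rewrite in_itv/=; apply/andP; split; first by rewrite (le_trans t0)// ltW.
by near: s; exact: nbhs_right_le.
Unshelve. all: by end_near. Qed.

(** The schedule is constrained on [[0, 1]] only; composed with this projection it becomes monotone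
    on the whole line, hence measurable. *)
Definition clamp01 (R : realType) (t : R) : R := Num.max 0 (Num.min 1 t).

Lemma clamp01_itv (R : realType) (t : R) : 0 <= clamp01 t <= 1.
Proof. by rewrite /clamp01 le_max lexx/= ge_max ler01 ge_min lexx. Qed.

Lemma clamp01_id (R : realType) (t : R) : 0 <= t <= 1 -> clamp01 t = t.
Proof. by move=> /andP[t0 t1]; rewrite /clamp01 min_r// max_r. Qed.

Lemma ler_clamp01 (R : realType) : {homo @clamp01 R : s t / s <= t}.
Proof.
by move=> s t st; rewrite /clamp01 ge_max !le_max lexx/= le_min !ge_min lexx st !orbT.
Qed.

Lemma schedule_nonincreasing (R : realType) (alpha : R -> R)
    (halpha : noise_schedule alpha) (s t : R) :
  0 <= s <= 1 -> 0 <= t <= 1 -> s <= t -> alpha t <= alpha s.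
Proof.
move=> s01 t01; rewrite le_eqVlt => /predU1P[->//|st].
by rewrite ltW// (schedule_decreasing halpha)// in_itv.
Qed.

Lemma measurable_clamped_schedule (R : realType) (alpha : R -> R)
    (halpha : noise_schedule alpha) :
  measurable_fun [set: R] (fun t => alpha (clamp01 t)).
Proof.
apply: nonincreasing_measurable => // s t st.
apply: (schedule_nonincreasing halpha); [exact: clamp01_itv..|exact: ler_clamp01].
Qed.

Lemma cvg_add_harmonic_right (R : realType) (t : R) :
  t + n.+1%:R^-1 @[n --> \oo] --> t^'+.
Proof.
move=> P [e /= e0 He].
suff : \forall n \near \oo, P (t + n.+1%:R^-1) by [].
near=> n; apply: He => /=.
  rewrite opprD addNKr normrN ger0_norm ?invr_ge0//.
  by near: n; exact: (near_infty_natSinv_lt (PosNum e0)).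
by rewrite ltrDl invr_gt0.
Unshelve. all: by end_near. Qed.

(** On [[0, 1[] the derivative is the pointwise limit of right difference quotients with step
    [1 / (n + 1)]. Clamping makes each of them measurable and changes nothing once
    [t + 1 / (n + 1) <= 1]. *)
Lemma measurable_derive_in_schedule (R : realType) (alpha : R -> R)
    (halpha : noise_schedule alpha) :
  measurable_fun (`[0, 1[ : set R) (derive_in `[0, 1] alpha).
Proof.
pose h n (t : R) :=
  (alpha (clamp01 (t + n.+1%:R^-1)) - alpha (clamp01 t)) * n.+1%:R.
have malpha := measurable_clamped_schedule halpha.
apply: (@measurable_fun_cvg _ _ _ _ h) => [n|t].
  apply: measurable_funTS; apply: measurable_funM => //.
  apply: measurable_funB => //.
  by apply: (measurableT_comp malpha); exact: measurable_funD.
rewrite /= in_itv/= => t01; have /andP[t0 t1] := t01.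
have := cvg_comp _ _ (@cvg_add_harmonic_right R t) (cvg_schedule_quotient_right halpha t01).
apply: cvg_trans; apply: near_eq_cvg; near=> n => /=.
have n1 : t + n.+1%:R^-1 <= 1.
  rewrite -lerBrDl ltW//; near: n.
  have t1' : 0 < 1 - t by rewrite subr_gt0.
  exact: (near_infty_natSinv_lt (PosNum t1')).
rewrite /h !clamp01_id ?t0 ?(ltW t1)//; last by rewrite n1 andbT addr_ge0.
by rewrite [X in _ / X]addrAC subrr add0r invrK.
Unshelve. all: by end_near. Qed.

(** * The substitution a = alpha(t) *)

Lemma integral_derive_in_schedule (R : realType) (alpha : R -> R)
    (halpha : noise_schedule alpha) (s : R) : 0 <= s <= 1 ->
  (\int[lebesgue_measure]_(t in `[0%R, s[) (- derive_in `[0%R, 1%R] alpha t)%:E =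
   (alpha 0 - alpha s)%:E)%E.
Proof.
move=> /andP[s0 s1].
rewrite (@integral_right_derivative R (fun t => - alpha t))//.
- by rewrite opprK addrC.
- apply: measurableT_comp => //.
  apply: (measurable_funS _ _ (measurable_derive_in_schedule halpha)) => //.
  by apply: subset_itvl; rewrite bnd_simp.
- move=> t /andP[t0 ts]; rewrite oppr_ge0 (derive_in_schedule_le0 halpha)//.
  by rewrite t0 (lt_le_trans ts).
- move=> t /andP[t0 ts]; apply: cvgN; apply: (schedule_left_continuous halpha).
  by rewrite t0 (le_trans ts).
- move=> t /andP[t0 ts].
  have /(cvg_schedule_quotient_right halpha)/cvgN : 0 <= t < 1 by rewrite t0 (lt_le_trans ts).
  apply: cvg_trans; apply: near_eq_cvg; near=> u.
  by rewrite -mulNr; congr (_ / _); rewrite opprB opprK addrC.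
Unshelve. all: by end_near. Qed.

(** Compares the image of [- alpha' dt] with Lebesgue measure on closed half-lines. For [0 < x <= 1]
    and [alpha s = x], the preimage is [[0, s]] and both sides equal [1 - x]; otherwise the preimage
    is all of [[0, 1[] or empty. *)
Lemma integral_derive_schedule_preimage (R : realType) (alpha : R -> R)
    (halpha : noise_schedule alpha) (alpha0 : alpha 0 = 1) (alpha1 : alpha 1 = 0)
    (x : R) :
  (\int[lebesgue_measure]_(t in (fun t => alpha (clamp01 t)) @^-1` `[x, +oo[ `&` `[0%R, 1%R[)
     (- derive_in `[0%R, 1%R] alpha t)%:E =
   lebesgue_measure (`[x, +oo[ `&` `[0%R, 1%R] : set R))%E.
Proof.
have [x0|x0] := leP x 0.
  have -> : (fun t => alpha (clamp01 t)) @^-1` `[x, +oo[ `&` `[0%R, 1%R[ = `[0%R, 1%R[%classic.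
    apply: setIidr => t _ /=; rewrite in_itv/= andbT (le_trans x0)//.
    have := schedule_range halpha (t := clamp01 t).
    by rewrite !in_itv/= => /(_ (clamp01_itv t)) /andP[].
  have -> : `[x, +oo[ `&` `[0%R, 1%R] = `[0%R, 1%R]%classic.
    by apply: setIidr => t /=; rewrite !in_itv/= andbT => /andP[t0 _]; exact: le_trans t0.
  rewrite (integral_derive_in_schedule halpha) ?lexx ?ler01// alpha0 alpha1.
  by rewrite lebesgue_measure_itv/= lte_fin ltr01 -EFinB.
have [x1|x1] := leP x 1; last first.
  have -> : `[x, +oo[ `&` `[0%R, 1%R] = set0 :> set R.
    by apply/seteqP; split => // t [] /=; rewrite !in_itv/= andbT => xt /andP[_]; lra.
  have -> : (fun t => alpha (clamp01 t)) @^-1` `[x, +oo[ `&` `[0%R, 1%R[ = set0.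
    apply/seteqP; split => // t [] /=; rewrite in_itv/= andbT => xt _.
    have := schedule_range halpha (t := clamp01 t).
    by rewrite !in_itv/= => /(_ (clamp01_itv t)) /andP[_]; lra.
  by rewrite integral_set0 measure0.
have [|s s01 sx] := schedule_surjective halpha alpha0 alpha1 (x := x).
  by rewrite ltW.
have /andP[s0 s1] := s01.
have {}s1 : s < 1.
  rewrite lt_neqAle s1 andbT; apply/eqP => sE.
  by move: x0; rewrite -sx sE alpha1 ltxx.
have -> : (fun t => alpha (clamp01 t)) @^-1` `[x, +oo[ `&` `[0%R, 1%R[ = `[0%R, s]%classic.
  apply/seteqP; split => t /=.
    move=> []; rewrite !in_itv/= andbT => xt /andP[t0 t1].
    rewrite t0/= leNgt; apply/negP => st.
    have ct : clamp01 t = t by rewrite clamp01_id// t0 ltW.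
    move: xt; rewrite ct -sx leNgt => /negP; apply.
    by apply: (schedule_decreasing halpha); rewrite // in_itv/= ?t0 ltW.
  rewrite !in_itv/= andbT => /andP[t0 ts]; have t1 := le_lt_trans ts s1.
  have ct : clamp01 t = t by rewrite clamp01_id// t0 ltW.
  rewrite t0 t1 ct -sx; split => //.
  by apply: (schedule_nonincreasing halpha) => //; rewrite t0 ltW.
have -> : `[x, +oo[ `&` `[0%R, 1%R] = `[x, 1%R]%classic :> set R.
  apply/seteqP; split => t /=; rewrite !in_itv/= andbT.
    by move=> [-> /andP[_ ->]].
  by move=> /andP[xt ->]; split => //; rewrite andbT (le_trans (ltW x0)).
rewrite -integral_itv_bndo_bndc; last first.
  apply/measurable_EFinP; apply: measurableT_comp => //.
  apply: (measurable_funS _ _ (measurable_derive_in_schedule halpha)) => //.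
  by apply: subset_itvl; rewrite bnd_simp ltW.
rewrite (integral_derive_in_schedule halpha)// alpha0 sx.
rewrite lebesgue_measure_itv/= lte_fin; move: x1; rewrite le_eqVlt.
by move=> /predU1P[->|x1]; [rewrite ltxx subrr|rewrite x1 -EFinB].
Qed.

(** Closed half-lines are stable under intersection and generate the Borel sets, so the two finite
    measures that agree on them are equal. The formula follows by integrating against the image
    measure and then unfolding the density. *)
Lemma integral_schedule_substitution (R : realType) (alpha : R -> R)
    (halpha : noise_schedule alpha) (alpha0 : alpha 0 = 1) (alpha1 : alpha 1 = 0)
    (F : R -> \bar R) :
  measurable_fun (`[0%R, 1%R] : set R) F ->
  (forall a, 0 <= a <= 1 -> (0 <= F a)%E) ->
  (\int[lebesgue_measure]_(a in `[0%R, 1%R]) F a =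
   \int[lebesgue_measure]_(t in `[0%R, 1%R[)
     (F (alpha t) * (- derive_in `[0%R, 1%R] alpha t)%:E))%E.
Proof.
move=> mF F0; set mu := @lebesgue_measure R.
pose w := (fun t : R => - derive_in `[0, 1] alpha t) \_ `[0, 1[.
have mw : measurable_fun [set: measurableTypeR R] w.
  apply/measurable_restrict => //; rewrite setTI; apply: measurableT_comp => //.
  exact: measurable_derive_in_schedule.
have w0 t : 0 <= w t.
  rewrite /w patchE; case: ifPn => // /set_mem; rewrite /= in_itv/= => t01.
  by rewrite oppr_ge0 (derive_in_schedule_le0 halpha).
pose T (t : measurableTypeR R) : measurableTypeR R := alpha (clamp01 t).
have mT : measurable_fun setT T by exact: measurable_clamped_schedule.
have T01 t : 0 <= T t <= 1.
  have := schedule_range halpha (t := clamp01 t).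
  by rewrite !in_itv/= => /(_ (clamp01_itv t)).
have nuE (A : set (measurableTypeR R)) : measurable A ->
    mu (A `&` `[0, 1]) = density mu mw w0 (T @^-1` A).
  (* The image of the density under [T], kept abstract as a bundled measure known by its values, in
     the form the uniqueness theorem takes. *)
  have [nu nuE] : exists nu : {measure set (measurableTypeR R) -> \bar R},
      forall B, nu B = density mu mw w0 (T @^-1` B).
    pose mfunT : {mfun _ >-> _} := HB.pack T (isMeasurableFun.Build _ _ _ _ _ mT).
    by unshelve eexists (pushforward (density mu mw w0) mfunT).
  move=> mA; rewrite -nuE.
  have m01 : measurable (`[0, 1]%classic : set (measurableTypeR R)) by [].
  pose m1 : {measure set (measurableTypeR R) -> \bar R} := mrestr mu m01.
  rewrite -[LHS]/(m1 A).
  apply: (@measure_unique _ R (measurableTypeR R) (@RGenCInfty.G R)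
    (fun k => `[- k%:R, +oo[%classic) _ _ _ _ m1 nu) => //.
  - exact: RGenCInfty.measurableE.
  - move=> _ _ [x ->] [y ->]; exists (Num.max x y).
    by apply/seteqP; split => t /=; rewrite !in_itv/= !andbT ge_max => /andP.
  - by move=> k; eexists.
  - apply/seteqP; split => // t _.
    exists (Num.trunc `|t|).+1 => //=; rewrite in_itv/= andbT lerNl.
    by rewrite (le_trans (ler_norm _))// normrN ltW// truncnS_gt.
  - move=> _ [x ->]; rewrite nuE.
    rewrite -[LHS]/(lebesgue_measure (`[x, +oo[ `&` `[0, 1] : set R)).
    rewrite -(integral_derive_schedule_preimage halpha)// /density /w.
    rewrite integral_mkcondr; apply: eq_integral => t _.
    by rewrite !patchE; case: ifPn.
  - move=> k; rewrite /m1 /mrestr.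
    apply: (@le_lt_trans _ _ (mu `[0, 1]%classic)).
      by apply: le_measure; rewrite ?inE//; exact: measurableI.
    by rewrite /mu lebesgue_measure_itv/= lte_fin ltr01 -EFinB ltry.
transitivity (\int[density mu mw w0]_(t in T @^-1` `[0%R, 1%R]) (F \o T) t)%E.
  rewrite -(ge0_integral_pushforward mT)//; last first.
    by move=> a /set_mem; rewrite /= in_itv/=; exact: F0.
  apply: eq_measure_integral => A mA A01.
  by rewrite -[RHS]/(density mu mw w0 (T @^-1` A)) -nuE// setIidl.
have -> : T @^-1` `[0, 1]%classic = setT by apply/seteqP; split => // t _ /=; rewrite in_itv/=.
rewrite (@ge0_integral_density _ _ _ mu _ w)//; last 2 first.
- have m01 : measurable (`[0, 1]%classic : set (measurableTypeR R)) by [].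
  have mF' : measurable_fun (`[0, 1]%classic : set (measurableTypeR R)) F by exact: mF.
  apply: (measurable_comp m01 _ mF' mT).
  by move=> _ [t _ <-] /=; rewrite in_itv/=.
- by move=> t _; apply: F0.
rewrite [RHS]integral_mkcond; apply: eq_integral => t _.
rewrite /w !patchE; case: ifPn => [/set_mem|_]; last by rewrite mule0.
rewrite /= in_itv/= => /andP[t0 t1].
by rewrite /T clamp01_id// t0 ltW.
Qed.

(** * Masked position sets and the two forward laws *)

Lemma mask_at_masked (L m : nat) (x0 : token_seq L m)
    (hx0 : forall l, x0 l <> mask_token m) (S : {set 'I_L}) (l : 'I_L) :
  (mask_at S x0 l == mask_token m) = (l \in S).
Proof. by rewrite ffunE; case: ifPn => _; [rewrite eqxx|apply/eqP/hx0]. Qed.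

Lemma nmask_mask_at (L m : nat) (x0 : token_seq L m)
    (hx0 : forall l, x0 l <> mask_token m) (S : {set 'I_L}) :
  nmask (mask_at S x0) = #|S|.
Proof. by apply: eq_card => l; rewrite inE; exact: mask_at_masked. Qed.

(** As [x0] has no mask token, [S] is recovered as the set of masked positions. *)
Lemma mask_at_inj (L m : nat) (x0 : token_seq L m)
    (hx0 : forall l, x0 l <> mask_token m) :
  injective (fun S : {set 'I_L} => mask_at S x0).
Proof.
by move=> S T ST; apply/setP => l; rewrite -!(mask_at_masked hx0) ST.
Qed.

Lemma forward_tokenE (R : realType) (m : nat) (alpha : R -> R) (t : R)
    (k y : 'I_(m + 1)) :
  forward_token alpha t k y 0 =
  alpha t * (y == k)%:R + (1 - alpha t) * (y == mask_token m)%:R.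
Proof. by rewrite !mxE eqxx !andbT. Qed.

Lemma forward_mask_at (R : realType) (L m : nat) (alpha : R -> R) (t : R)
    (x0 : token_seq L m) (hx0 : forall l, x0 l <> mask_token m)
    (S : {set 'I_L}) :
  forward alpha t x0 (mask_at S x0) =
  alpha t ^+ (L - #|S|) * (1 - alpha t) ^+ #|S|.
Proof.
rewrite /forward (bigID [in S])/= mulrC; congr (_ * _).
  rewrite (eq_bigr (fun=> alpha t)) => [|l /negPf lS].
    have SL : (L - #|S| = #|[predC S]|)%N.
      by apply: (canLR (addKn _)); rewrite cardC card_ord.
    by rewrite prodr_const SL.
  by rewrite forward_tokenE mask_at_masked// ffunE lS eqxx mulr1 mulr0 addr0.
rewrite (eq_bigr (fun=> 1 - alpha t)) => [|l lS]; first by rewrite prodr_const.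
rewrite forward_tokenE mask_at_masked// ffunE lS mulr1.
by rewrite eq_sym (negPf (introN eqP (hx0 l))) mulr0 add0r.
Qed.

(** Were every token of [x] either kept or masked, [x] would be [mask_at S x0] for its set [S] of
    masked positions. So some token is neither, and its factor in the product is 0. *)
Lemma forward_outside (R : realType) (L m : nat) (alpha : R -> R) (t : R)
    (x0 x : token_seq L m) :
  (forall S, mask_at S x0 != x) -> forward alpha t x0 x = 0.
Proof.
move=> xS.
have : [exists l, ~~ ((x l == x0 l) || (x l == mask_token m))].
  rewrite -negb_forall; apply/negP => /forallP h.
  have /eqP := xS [set l | x l == mask_token m]%SET; apply.
  apply/ffunP => l; rewrite ffunE inE.
  have /orP[/eqP ->|/eqP ->] := h l; last by rewrite eqxx.
  by case: eqP => [<-|].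
move=> /existsP[l]; rewrite negb_or => /andP[/negPf xl /negPf xm].
by rewrite /forward (bigD1 l)//= forward_tokenE xl xm !mulr0 addr0 mul0r.
Qed.

(** The sum has at most one term, by injectivity. This shape presents the law as a push-forward from
    position sets, like [discrete_forward]. *)
Lemma forwardE (R : realType) (L m : nat) (alpha : R -> R) (t : R)
    (x0 : token_seq L m) (hx0 : forall l, x0 l <> mask_token m)
    (x : token_seq L m) :
  forward alpha t x0 x = \sum_(S | mask_at S x0 == x)
    alpha t ^+ (L - #|S|) * (1 - alpha t) ^+ #|S|.
Proof.
have [/existsP[S /eqP <-]|] := boolP [exists S, mask_at S x0 == x].
  rewrite (big_pred1 S) ?forward_mask_at// => T.
  by apply/eqP/eqP => [/(mask_at_inj hx0)|->].
rewrite negb_exists => /forallP xS; rewrite forward_outside//.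
by rewrite big_pred0// => S; apply: negbTE; exact: xS.
Qed.

(** Change of variables along [S |-> mask_at S x0]: [P] is trivial for the continuous-time law and
    fixes the cardinality for the discrete one. Nonnegative weights distribute over sums in the
    extended reals whatever the values of [F]. *)
Lemma expect_mask_at (R : realType) (L m : nat) (x0 : token_seq L m)
    (P : pred {set 'I_L}) (q : {set 'I_L} -> R) (p : token_seq L m -> R)
    (F : token_seq L m -> \bar R) :
  (forall S, P S -> 0 <= q S) ->
  (forall x, p x = \sum_(S | P S && (mask_at S x0 == x)) q S) ->
  expect p F = (\sum_(S | P S) (q S)%:E * F (mask_at S x0))%E.
Proof.
move=> q0 pE; rewrite /expect (partition_big (fun S => mask_at S x0) predT)//=.
apply: eq_bigr => x _; rewrite pE -sumEFin ge0_sume_distrl.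
  by apply: eq_bigr => S /andP[_ /eqP ->].
by move=> S /andP[PS _]; rewrite lee_fin q0.
Qed.

(** * Network entries, the Beta law and the inverse schedule *)

Lemma network_entry_itv (R : realType) (L m : nat)
    (mu : token_seq L m -> R -> 'M[R]_(m + 1, L)) (hmu : data_prediction_network mu)
    (x : token_seq L m) (t : R) (k : 'I_(m + 1)) (l : 'I_L) :
  0 <= mu x t k l <= 1.
Proof.
have [p0 p1] := network_simplex hmu x t l.
have pE i : col l (mu x t) i 0 = mu x t i l by rewrite mxE.
rewrite -pE p0/= -p1 (bigD1 k)//= lerDl sumr_ge0// => i _; exact: p0.
Qed.

(** Such an entry is a softmax value. Positivity makes every logarithm occurring in the losses a
    real number. *)
Lemma network_data_entry_gt0 (R : realType) (L m : nat)
    (mu : token_seq L m -> R -> 'M[R]_(m + 1, L)) (hmu : data_prediction_network mu)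
    (x : token_seq L m) (t : R) (k : 'I_(m + 1)) (l : 'I_L) :
  x l = mask_token m -> k <> mask_token m -> 0 < mu x t k l.
Proof.
move=> xl; have [f fE] := network_masked hmu t xl.
have -> : mu x t k l = col l (mu x t) k 0 by rewrite mxE.
rewrite fE; have [i ->|j ->] := split_ordP k; last by rewrite ord1.
move=> _; rewrite col_mxEu mxE divr_gt0 ?expR_gt0//.
by rewrite (bigD1 i)//= ltr_pwDl ?expR_gt0// sumr_ge0 => [|j _]; rewrite ?expR_ge0.
Qed.

(** Both sides are [(L - n)! (n - 1)! / L!]. *)
Lemma beta_fun_bin (R : realType) (L n : nat) : (0 < n <= L)%N ->
  ('C(L, n)%:R)^-1 * n%:R^-1 = beta_fun (L - n + 1) n :> R.
Proof.
case: n => // n /= nL; rewrite addn1 beta_fun_fact.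
have -> : (L - n.+1 + n).+1 = L by lia.
rewrite -[in RHS](bin_fact nL) factS !natrM.
have C0 : ('C(L, n.+1)%:R : R) != 0 by rewrite pnatr_eq0 -lt0n bin_gt0.
have n0 : (n.+1%:R : R) != 0 by rewrite pnatr_eq0.
have f1 : (n`!%:R : R) != 0 by rewrite pnatr_eq0 -lt0n fact_gt0.
have f2 : ((L - n.+1)`!%:R : R) != 0 by rewrite pnatr_eq0 -lt0n fact_gt0.
move: ('C(L, n.+1)%:R : R) (n.+1%:R : R) (n`!%:R : R) ((L - n.+1)`!%:R : R) C0 n0 f1 f2.
by move=> c k p q c0 k0 p0 q0; field; rewrite c0 k0 p0 q0.
Qed.

Lemma ge0_integral_beta_prob (R : realType) (a b : nat) (f : R -> \bar R) :
  measurable_fun (`[0%R, 1%R] : set R) f ->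
  (forall x, 0 <= x <= 1 -> (0 <= f x)%E) ->
  (\int[beta_prob a b]_(x in `[0%R, 1%R]) f x =
   \int[lebesgue_measure]_(x in `[0%R, 1%R]) (f x * (beta_pdf a b x)%:E))%E.
Proof.
move=> mf f0; apply: (@ge0_integral_density _ _ _ lebesgue_measure) => //.
- exact: measurable_beta_pdf.
- by move=> x; exact: beta_pdf_ge0.
- by move=> A mA; rewrite integral_beta_pdf.
Qed.

(** Since [alpha] maps [[0, 1]] onto itself, [halphaV] determines [alphaV] on [[0, 1]], where it is
    nonincreasing because [alpha] is decreasing; clamping extends this to the line. *)
Lemma measurable_schedule_inverse (R : realType) (alpha alphaV : R -> R)
    (halpha : noise_schedule alpha) (alpha0 : alpha 0 = 1) (alpha1 : alpha 1 = 0)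
    (halphaV : forall t : R, t \in `[0, 1] -> alphaV (alpha t) = t) :
  measurable_fun (`[0%R, 1%R] : set R) alphaV.
Proof.
have inv a : 0 <= a <= 1 -> exists t, [/\ 0 <= t <= 1, alpha t = a & alphaV a = t].
  move=> /(schedule_surjective halpha alpha0 alpha1)[t t01 <-]; exists t.
  by split => //; apply: halphaV; rewrite in_itv.
apply: (@eq_measurable_fun _ _ _ _ _ (alphaV \o @clamp01 R)).
  by move=> t /set_mem; rewrite /= in_itv/= => t01; rewrite clamp01_id.
apply: measurable_funTS; apply: nonincreasing_measurable => // a b ab /=.
have [s [s01 sa ->]] := inv _ (clamp01_itv a).
have [t [t01 tb ->]] := inv _ (clamp01_itv b).
rewrite leNgt; apply/negP => st.
have := ler_clamp01 ab; rewrite -sa -tb leNgt => /negP; apply.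
by apply: (schedule_decreasing halpha) => //; rewrite in_itv.
Qed.

(** * Losses of single masked tokens *)

(** The sign makes it nonnegative, as the integration lemmas require. For [l \in S] the entry is
    positive, so the real [ln] agrees there with the extended logarithm. *)
Definition token_loss (R : realType) (L m : nat)
    (mu : token_seq L m -> R -> 'M[R]_(m + 1, L)) (x0 : token_seq L m)
    (S : {set 'I_L}) (l : 'I_L) (t : R) : R :=
  - ln (mu (mask_at S x0) t (x0 l) l).

Lemma token_loss_ge0 (R : realType) (L m : nat)
    (mu : token_seq L m -> R -> 'M[R]_(m + 1, L)) (hmu : data_prediction_network mu)
    (x0 : token_seq L m) (S : {set 'I_L}) (l : 'I_L) (t : R) :
  0 <= token_loss mu x0 S l t.
Proof.
have /andP[_ mu1] := network_entry_itv hmu (mask_at S x0) t (x0 l) l.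
by rewrite oppr_ge0 ln_le0.
Qed.

Lemma logmx_mask_at (R : realType) (L m : nat)
    (mu : token_seq L m -> R -> 'M[R]_(m + 1, L)) (hmu : data_prediction_network mu)
    (x0 : token_seq L m) (hx0 : forall l, x0 l <> mask_token m)
    (S : {set 'I_L}) (l : 'I_L) (t : R) : l \in S ->
  logmx (mu (mask_at S x0) t) (x0 l) l = (- (token_loss mu x0 S l t)%:E)%E.
Proof.
move=> lS; rewrite mxE /lne leNgt network_data_entry_gt0//=.
  by rewrite opprK.
by apply/eqP; rewrite mask_at_masked.
Qed.

(** The loss at time [alphaV a] times the unnormalised density of Beta(L - |S| + 1, |S|). It is
    summed over [l \in S] only, where [#|S|] is positive and the predecessor is a true
    subtraction. *)
Definition weighted_loss (R : realType) (L m : nat) (alphaV : R -> R)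
    (mu : token_seq L m -> R -> 'M[R]_(m + 1, L)) (x0 : token_seq L m)
    (S : {set 'I_L}) (l : 'I_L) (a : R) : R :=
  a ^+ (L - #|S|) * (1 - a) ^+ #|S|.-1 * token_loss mu x0 S l (alphaV a).

Lemma weighted_loss_ge0 (R : realType) (L m : nat) (alphaV : R -> R)
    (mu : token_seq L m -> R -> 'M[R]_(m + 1, L)) (hmu : data_prediction_network mu)
    (x0 : token_seq L m) (S : {set 'I_L}) (l : 'I_L) (a : R) :
  0 <= a <= 1 -> 0 <= weighted_loss alphaV mu x0 S l a.
Proof.
move=> /andP[a0 a1]; rewrite !mulr_ge0 ?exprn_ge0 ?subr_ge0//.
exact: token_loss_ge0.
Qed.

Lemma measurable_token_loss (R : realType) (L m : nat) (alpha alphaV : R -> R)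
    (halpha : noise_schedule alpha) (alpha0 : alpha 0 = 1) (alpha1 : alpha 1 = 0)
    (halphaV : forall t : R, t \in `[0, 1] -> alphaV (alpha t) = t)
    (mu : token_seq L m -> R -> 'M[R]_(m + 1, L)) (hmu : data_prediction_network mu)
    (x0 : token_seq L m) (S : {set 'I_L}) (l : 'I_L) :
  measurable_fun (`[0%R, 1%R] : set R) (fun a => token_loss mu x0 S l (alphaV a)).
Proof.
have mV := measurable_schedule_inverse halpha alpha0 alpha1 halphaV.
have mmu := measurableT_comp (network_measurable hmu (mask_at S x0) (x0 l) l) mV.
by apply: (measurableT_comp _ (measurableT_comp (@measurable_ln R) mmu)).
Qed.

Lemma measurable_weighted_loss (R : realType) (L m : nat) (alpha alphaV : R -> R)
    (halpha : noise_schedule alpha) (alpha0 : alpha 0 = 1) (alpha1 : alpha 1 = 0)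
    (halphaV : forall t : R, t \in `[0, 1] -> alphaV (alpha t) = t)
    (mu : token_seq L m -> R -> 'M[R]_(m + 1, L)) (hmu : data_prediction_network mu)
    (x0 : token_seq L m) (S : {set 'I_L}) (l : 'I_L) :
  measurable_fun (`[0%R, 1%R] : set R) (weighted_loss alphaV mu x0 S l).
Proof.
apply: measurable_funM.
  apply: measurable_funM; first exact: measurable_funX.
  by apply: measurable_funX; exact: measurable_funB.
exact: (measurable_token_loss halpha).
Qed.

Lemma log_mubar_mask_at (R : realType) (L m : nat) (alpha alphaV : R -> R)
    (halpha : noise_schedule alpha) (alpha0 : alpha 0 = 1) (alpha1 : alpha 1 = 0)
    (halphaV : forall t : R, t \in `[0, 1] -> alphaV (alpha t) = t)
    (mu : token_seq L m -> R -> 'M[R]_(m + 1, L)) (hmu : data_prediction_network mu)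
    (x0 : token_seq L m) (hx0 : forall l, x0 l <> mask_token m)
    (S : {set 'I_L}) (l : 'I_L) : l \in S ->
  (log_mubar alphaV mu (mask_at S x0) (x0 l) l =
   - ((beta_fun (L - #|S| + 1) #|S|)^-1%:E *
      \int[lebesgue_measure]_(a in `[0%R, 1%R])
        (weighted_loss alphaV mu x0 S l a)%:E))%E.
Proof.
move=> lS; rewrite mxE nmask_mask_at//.
have ml := measurable_token_loss halpha alpha0 alpha1 halphaV hmu x0 S l.
have mw := measurable_weighted_loss halpha alpha0 alpha1 halphaV hmu x0 S l.
have p0 a := token_loss_ge0 hmu x0 S l a.
under eq_integral do rewrite logmx_mask_at//.
rewrite integral_ge0N; last by move=> a _; rewrite lee_fin.
congr (- _)%E; rewrite ge0_integral_beta_prob; last 2 first.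
- exact/measurable_EFinP.
- by move=> a _; rewrite lee_fin.
rewrite -ge0_integralZl_EFin//; last 3 first.
- by move=> a; rewrite /= in_itv/= => a01; rewrite lee_fin weighted_loss_ge0.
- exact/measurable_EFinP.
- by rewrite invr_ge0 beta_fun_ge0.
apply: eq_integral => a a01; rewrite -!EFinM; congr (_%:E).
(* Shape parameters enter the density lowered by one, which gives the exponents [L - #|S|] and
   [#|S|.-1]. *)
rewrite /beta_pdf patchE a01 /weighted_loss /XMonemX addn1 /=.
by rewrite mulrC [RHS]mulrC mulrAC.
Qed.

(** * Both sides as sums over masked position sets *)

(** The integrals on the right are gathered into that of a single [F]; after the substitution it
    remains to compare the integrands in [t]. *)
Lemma nelboE (R : realType) (L m : nat) (alpha alphaV : R -> R)
    (halpha : noise_schedule alpha) (alpha0 : alpha 0 = 1) (alpha1 : alpha 1 = 0)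
    (halphaV : forall t : R, t \in `[0, 1] -> alphaV (alpha t) = t)
    (mu : token_seq L m -> R -> 'M[R]_(m + 1, L)) (hmu : data_prediction_network mu)
    (x0 : token_seq L m) (hx0 : forall l, x0 l <> mask_token m) :
  (nelbo alpha mu x0 = \sum_(S : {set 'I_L}) \sum_(l in S)
     \int[lebesgue_measure]_(a in `[0%R, 1%R])
       (weighted_loss alphaV mu x0 S l a)%:E)%E.
Proof.
have mw := measurable_weighted_loss halpha alpha0 alpha1 halphaV hmu x0.
have w0 := weighted_loss_ge0 alphaV hmu x0.
pose F (a : R) : \bar R := (\sum_(S : {set 'I_L}) \sum_(l in S)
   (weighted_loss alphaV mu x0 S l a)%:E)%E.
have F0 a : 0 <= a <= 1 -> (0 <= F a)%E.
  by move=> a01; do 2 (apply: sume_ge0 => ? _); rewrite lee_fin w0.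
have mw' S l : measurable_fun (`[0%R, 1%R] : set R)
    (fun a => (weighted_loss alphaV mu x0 S l a)%:E).
  by apply/measurable_EFinP; exact: mw.
have mS (S : {set 'I_L}) : measurable_fun (`[0%R, 1%R] : set R)
    (fun a => \sum_(l in S) (weighted_loss alphaV mu x0 S l a)%:E)%E.
  rewrite (_ : (fun _ => _) =
      fun a => (\sum_(l <- enum S) (weighted_loss alphaV mu x0 S l a)%:E)%E).
    exact: emeasurable_sum.
  by apply/funext => a; rewrite big_enum.
have mF : measurable_fun (`[0%R, 1%R] : set R) F by exact: emeasurable_sum.
transitivity (\int[lebesgue_measure]_(a in `[0%R, 1%R]) F a)%E; last first.
  rewrite ge0_integral_sum//; last first.
    move=> S a; rewrite /= in_itv/= => a01.
    by apply: sume_ge0 => l _; rewrite lee_fin w0.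
  apply: eq_bigr => S _; under eq_integral do rewrite -big_enum/=.
  rewrite ge0_integral_sum ?big_enum//.
    exact: mw'.
  by move=> l a; rewrite /= in_itv/= => a01; rewrite lee_fin w0.
rewrite (integral_schedule_substitution halpha)// /nelbo.
pose K t : \bar R := (F (alpha t) * (- derive_in `[0%R, 1%R] alpha t)%:E)%E.
pose I t : \bar R := ((derive_in `[0%R, 1%R] alpha t / (1 - alpha t))%R%:E *
  expect (forward alpha t x0) (fun x =>
    (\sum_(l | x l == mask_token m) logmx (mu x t) (x0 l) l)%E))%E.
rewrite -[LHS]/(\int[lebesgue_measure]_(t in `[0%R, 1%R]) I t)%E.
rewrite -[RHS]/(\int[lebesgue_measure]_(t in `[0%R, 1%R[) K t)%E.
(* The open interval suffices, its endpoints being negligible, and it avoids [t = 0], where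
   [1 - alpha t] vanishes. *)
have IK t : 0 < t < 1 -> I t = K t.
  move=> /andP[t0 t1].
  have at1 : alpha t < 1.
    by rewrite -alpha0; apply: (schedule_decreasing halpha) => //;
      rewrite in_itv/= ?lexx ?ler01// !ltW.
  have /andP[at0 _] : 0 <= alpha t <= 1.
    by have := schedule_range halpha (t := t); rewrite !in_itv/= (ltW t0) (ltW t1); apply.
  rewrite /I /K (expect_mask_at (x0 := x0) (P := predT)
      (q := fun S => alpha t ^+ (L - #|S|) * (1 - alpha t) ^+ #|S|)); last 2 first.
  - by move=> S _; rewrite mulr_ge0// exprn_ge0// subr_ge0 ltW.
  - by move=> x; exact: forwardE.
  (* A factor [1 - alpha t] is drawn out of every term, to cancel the denominator of the NELBO
     weight. *)
  rewrite (eq_bigr (fun S : {set 'I_L} => ((1 - alpha t) *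
      - \sum_(l in S) weighted_loss alphaV mu x0 S l (alpha t))%:E)); last first.
    move=> S _; rewrite (eq_bigl (mem S)) => [|l]; last exact: mask_at_masked.
    rewrite (eq_bigr (fun l => (- token_loss mu x0 S l t)%:E)) => [|l lS].
      rewrite sumEFin -EFinM; congr (_%:E).
      rewrite sumrN !mulrN; congr (- _); rewrite !mulr_sumr; apply: eq_bigr => l lS.
      rewrite /weighted_loss halphaV ?in_itv/= ?ltW//.
      (* Having [l \in S] makes [S] nonempty, so its power of [1 - alpha t] has a factor to give. *)
      have -> : #|S| = #|S|.-1.+1 by rewrite prednK//; apply/card_gt0P; exists l.
      by rewrite exprS/=; ring.
    by rewrite logmx_mask_at.
  rewrite /F; under [in RHS]eq_bigr do rewrite sumEFin.
  rewrite !sumEFin -!EFinM; congr (_%:E).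
  rewrite -mulr_sumr sumrN.
  have : 1 - alpha t != 0 by rewrite subr_eq0 gt_eqF.
  by move: (\sum_(S : {set 'I_L}) _) => s a1; field.
have mK : measurable_fun (`]0%R, 1%R[ : set R) K.
  have sub01 : (`]0%R, 1%R[ : set R) `<=` `[0%R, 1%R[.
    by apply: subset_itvr; rewrite bnd_simp.
  apply: emeasurable_funM; last first.
    apply/measurable_EFinP; apply: measurableT_comp => //.
    by apply: (measurable_funS _ sub01); [|exact: measurable_derive_in_schedule].
  have range01 t : 0 <= alpha (clamp01 t) <= 1.
    have := schedule_range halpha (t := clamp01 t).
    by rewrite !in_itv/= => /(_ (clamp01_itv t)).
  apply: (@eq_measurable_fun _ _ _ _ _ (F \o (fun t => alpha (clamp01 t)))).
    move=> t /set_mem; rewrite /= in_itv/= => /andP[t0 t1].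
    by rewrite clamp01_id// !ltW.
  apply: (measurable_comp _ _ mF) => //.
    by move=> _ [t _ <-] /=; rewrite in_itv/=.
  by apply: measurable_funTS; exact: measurable_clamped_schedule.
have mI : measurable_fun (`]0%R, 1%R[ : set R) I.
  apply: eq_measurable_fun mK => t /set_mem; rewrite /= in_itv/= => t01.
  by rewrite IK.
rewrite (integral_itv_bndoo _ _ mI) (integral_itv_bndoo _ _ mK).
by apply: eq_integral => t /set_mem; rewrite /= in_itv/=; exact: IK.
Qed.

(** The uniform weight [1 / C(L, n)], the factor [1 / n] and the Beta normalisation
    [1 / B(L - n + 1, n)] multiply to 1. Signs leave the sums by nonnegativity, as the integrals may
    be infinite. *)
Lemma expect_discrete_forward (R : realType) (L m : nat) (alpha alphaV : R -> R)
    (halpha : noise_schedule alpha) (alpha0 : alpha 0 = 1) (alpha1 : alpha 1 = 0)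
    (halphaV : forall t : R, t \in `[0, 1] -> alphaV (alpha t) = t)
    (mu : token_seq L m -> R -> 'M[R]_(m + 1, L)) (hmu : data_prediction_network mu)
    (x0 : token_seq L m) (hx0 : forall l, x0 l <> mask_token m)
    (n : nat) (n0 : (0 < n)%N) :
  (expect (discrete_forward R n x0) (fun x => (n%:R^-1)%:E *
     \sum_(l | x l == mask_token m) log_mubar alphaV mu x (x0 l) l) =
   - \sum_(S : {set 'I_L} | #|S| == n) \sum_(l in S)
     \int[lebesgue_measure]_(a in `[0%R, 1%R])
       (weighted_loss alphaV mu x0 S l a)%:E)%E.
Proof.
have J0 (S : {set 'I_L}) l : (0 <= \int[lebesgue_measure]_(a in `[0%R, 1%R])
    (weighted_loss alphaV mu x0 S l a)%:E)%E.
  apply: integral_ge0 => a; rewrite /= in_itv/= => a01.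
  by rewrite lee_fin weighted_loss_ge0.
rewrite (expect_mask_at (x0 := x0) (P := fun S => #|S| == n)
    (q := fun=> ('C(L, n)%:R)^-1)) => [|S _|x]; [|by rewrite invr_ge0|by []].
rewrite -sumeN; last by move=> S T _ _; apply: ge0_adde_def; rewrite inE sume_ge0.
apply: eq_bigr => S /eqP Sn.
rewrite (eq_bigl (mem S)) => [|l]; last exact: mask_at_masked.
have nL : (0 < n <= L)%N by rewrite n0 -Sn -[X in (_ <= X)%N]card_ord max_card.
rewrite (eq_bigr (fun l => - ((beta_fun (L - n + 1) n)^-1%:E *
    \int[lebesgue_measure]_(a in `[0%R, 1%R]) (weighted_loss alphaV mu x0 S l a)%:E))%E);
  last by move=> l lS; rewrite (log_mubar_mask_at halpha)// Sn.
have b0 : (0 <= (beta_fun (L - n + 1) n)^-1%:E :> \bar R)%E.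
  by rewrite lee_fin invr_ge0 beta_fun_ge0.
rewrite sumeN; last first.
  by move=> l k _ _; apply: ge0_adde_def; rewrite inE mule_ge0.
rewrite -ge0_sume_distrr; last by move=> l _; exact: J0.
rewrite !muleN; congr (- _)%E.
rewrite !muleA -!EFinM beta_fun_bin// mulfV ?mul1e//.
by rewrite gt_eqF// beta_fun_gt0.
Qed.

(** * Grouping by the number of masked tokens *)

Theorem proposition3p1 (R : realType) (L m : nat) (hL : (1 <= L)%N)
    (alpha alphaV : R -> R)
    (halpha : noise_schedule alpha)
    (halpha0 : alpha 0 = 1) (halpha1 : alpha 1 = 0)
    (halphaV : forall t : R, t \in `[0, 1] -> alphaV (alpha t) = t)
    (mu : token_seq L m -> R -> 'M[R]_(m + 1, L))
    (hmu : data_prediction_network mu)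
    (x0 : token_seq L m) (hx0 : forall l : 'I_L, x0 l <> mask_token m) :
  nelbo alpha mu x0 =
    (- \sum_(1 <= n < L.+1)
         expect (discrete_forward R n x0) (fun x =>
           ((n%:R^-1)%:E *
           \sum_(l | x l == mask_token m) log_mubar alphaV mu x (x0 l) l)%E))%E.
Proof.
rewrite (nelboE halpha halpha0 halpha1 halphaV hmu hx0).
pose J (S : {set 'I_L}) := (\sum_(l in S) \int[lebesgue_measure]_(a in `[0%R, 1%R])
  (weighted_loss alphaV mu x0 S l a)%:E)%E.
rewrite -[LHS]/(\sum_(S : {set 'I_L}) J S)%E.
have J0 S : (0 <= J S)%E.
  apply: sume_ge0 => l _; apply: integral_ge0 => a; rewrite /= in_itv/= => a01.
  by rewrite lee_fin weighted_loss_ge0.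
rewrite (eq_big_nat _ _ (F2 := fun n => (- \sum_(S : {set 'I_L} | #|S| == n) J S)%E));
  last by move=> n /andP[n0 _]; rewrite (expect_discrete_forward halpha).
rewrite sumeN; last by move=> i j _ _; apply: ge0_adde_def; rewrite inE sume_ge0.
(* Cardinalities are at most [L], so [inord] loses nothing when they index the partition. *)
rewrite oppeK (partition_big (fun S : {set 'I_L} => inord #|S| : 'I_L.+1) predT)//=.
transitivity (\sum_(0 <= n < L.+1) \sum_(S : {set 'I_L} | #|S| == n) J S)%E.
  rewrite big_mkord; apply: eq_bigr => n _; apply: eq_bigl => S.
  rewrite -val_eqE/= inordK// ltnS -[X in (_ <= X)%N]card_ord; exact: max_card.
(* The term [n = 0], absent from the statement, comes from the empty set alone, whose inner sum is
   empty. *)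
rewrite [LHS]big_ltn// [X in (X + _)%E]big1 ?add0e// => S; rewrite cards_eq0 => /eqP ->.
by rewrite /J big_set0.
Qed.
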